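(* Let $f_1,\ldots,f_m : \mathbb{R}^d \to \mathbb{R}$ be homogeneous rational linear forms. If all the forms are different but have equal weight, then for positive integers $t$ \begin{align*} A^{*\circ}(t) &= \sum_{u \in \mathcal{L}(\mathcal{H})} \mu(\hat 0,u)\, E_{(0,1)^d \cap u}(t), \\ A^*(t) &= \sum_{u \in \mathcal{L}(\mathcal{H})} |\mu(\hat 0,u)|\, E_{[0,1]^d \cap u}(t), \end{align*} where $\mu$ is the Möbius function of $\mathcal{L}(\mathcal{H})$; and similarly \begin{align*} A^{\circ}(t) &= \sum_{u \in \mathcal{L}(\mathcal{H}[K_m]^\sharp)} \mu(\hat 0,u)\, E_{(0,1)^d \cap u}(t), \\ A(t) &= \sum_{u \in \mathcal{L}(\mathcal{H}[K_m]^\sharp)} |\mu(\hat 0,u)|\, E_{[0,1]^d \cap u}(t), \end{align*} where $\mu$ is the Möbius function of $\mathcal{L}(\mathcal{H}[K_m]^\sharp)$.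
   Context: The weight of a linear form is the sum of its coefficients, i.e. its value at $(1,\dots,1)$. For positive integers $t$: $A^\circ(t)$ is the number of integer points $x\in(0,t)^d$ such that the values $f_1(x),\dots,f_m(x)$ are all distinct; $A^{*\circ}(t)$ is the number of such points $x$ in which all entries $x_1,\dots,x_d$ are also distinct. $\mathcal{H}[K_m]^\sharp$ is the hyperplane arrangement in $\mathbb{R}^d$ consisting of the sets $\{x: f_j(x)=f_k(x)\}$, $1\le j<k\le m$; $\mathcal{H}[K_d]$ is the arrangement of all hyperplanes $x_i=x_j$, $1\le i<j\le d$, in $\mathbb{R}^d$; and $\mathcal{H}=\mathcal{H}[K_m]^\sharp\cup\mathcal{H}[K_d]$. For $x\in\mathbb{R}^d$, $m(x)$ (respectively $m^*(x)$) is the number of closed regions (closures of connected components of the complement in $\mathbb{R}^d$) of $\mathcal{H}[K_m]^\sharp$ (respectively $\mathcal{H}$) that contain $x$. For positive integers $t$, $A(t)=\sum_x m(x)$ and $A^*(t)=\sum_x m^*(x)$, the sums being over all integer points $x\in[0,t]^d$. For an arrangement $\mathcal{K}$, $\mathcal{L}(\mathcal{K})=\{\bigcap\mathcal{S}:\mathcal{S}\subseteq\mathcal{K},\ \bigcap\mathcal{S}\ne\varnothing\}$ ordered by reverse inclusion, with minimum $\hat 0=\mathbb{R}^d$. The Möbius function of a finite poset is defined by $\mu(r,s)=0$ if $r\not\le s$, $\mu(r,r)=1$, and $\mu(r,s)=-\sum_{r\le u<s}\mu(r,u)$ if $r<s$. For a bounded set $Q\subset\mathbb{R}^d$, $E_Q(t)=\#(Q\cap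 t^{-1}\mathbb{Z}^d)$. *)

(* Defs.v *)
From HB Require Import structures.
From mathcomp Require Import all_boot all_order all_algebra.
From mathcomp Require Import finmap.
From mathcomp Require Import all_classical all_reals all_analysis.

Set Implicit Arguments.
Unset Strict Implicit.
Unset Printing Implicit Defensive.

Import Order.TTheory GRing.Theory Num.Theory.
Import numFieldNormedType.Exports.

Local Open Scope classical_set_scope.
Local Open Scope ring_scope.

(* Meaningful for finite sets only: an infinite set gets the value 0. *)
Definition card (T : choiceType) (A : set T) : nat := #|` fset_set A|%fset.

Section Mobius.
Context {disp : Order.disp_t} {T : porderType disp}.
Variable P : set T.

Fixpoint mobius_rec (n : nat) (r s : T) : int :=
  if n is n'.+1 then
    if r == s then 1
    else if (r < s)%O then
      - \sum_(u \in P `&` [set u | (r <= u < s)%O]) mobius_rec n' r u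
    else 0
  else 0.

(* The Moebius function of the finite poset P (with the order of T). The first
   argument of mobius_rec only bounds the depth of the recursion; mobius_id,
   mobius_nle and mobius_lt below are the defining equations. *)
Definition mobius (r s : T) : int := mobius_rec (card P).+1 r s.

Lemma mobius_id r : mobius r r = 1.
Proof. by rewrite /mobius /= eqxx. Qed.

Lemma mobius_nle r s : ~~ (r <= s)%O -> mobius r s = 0.
Proof.
move=> nrs; rewrite /mobius /=; case: eqVneq nrs => [->|_]; first by rewrite lexx.
by case: ifP => // /ltW ->.
Qed.

Lemma mobius_lt r s : finite_set P -> (r < s)%O ->
  mobius r s = - \sum_(u \in P `&` [set u | (r <= u < s)%O]) mobius r u.
Proof.
move=> finP rs.
pose I s := P `&` [set u | (r <= u < s)%O].
have finI v : finite_set (I v) by apply: sub_finite_set finP => x [].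
have ltI u v : I v u -> (card (I u) < card (I v))%N.
  move=> [Pu /andP[ru uv]]; apply: fproper_ltn_card.
  rewrite fproperE; apply/andP; split.
    apply/fsubsetP => x; rewrite !in_fset_set // => /set_mem[Px /andP[rx xu]].
    by apply/mem_set; split=> //=; rewrite rx (lt_trans xu uv).
  apply/fsubsetPn; exists u; rewrite in_fset_set //.
    by apply/mem_set; split=> //=; rewrite ru.
  by apply/negP => /set_mem[_ /andP[_]]; rewrite ltxx.
have stab n : forall v, (card (I v) < n)%N ->
    mobius_rec n r v = mobius_rec n.+1 r v.
  elim: n => [//|n IHn] v lv.
  rewrite [LHS]/= [RHS]/=; case: eqVneq => // _; case: ifP => // _; congr (- _).
  apply: eq_fsbigr => u /set_mem /ltI luv; apply: IHn.
  exact: leq_trans luv _.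
rewrite {1}/mobius /= lt_eqF // rs; congr (- _).
apply: eq_fsbigr => u /set_mem[Pu _]; apply: stab; apply: fproper_ltn_card.
rewrite fproperE; apply/andP; split.
  by apply/fsubsetP => x; rewrite !in_fset_set // => /set_mem[Px _]; apply/mem_set.
apply/fsubsetPn; exists u; rewrite in_fset_set //; first exact/mem_set.
by apply/negP => /set_mem[_ /andP[_]]; rewrite ltxx.
Qed.

End Mobius.

Section Arrangements.
Context {R : realType} {d : nat}.
Local Notation V := 'rV[R]_d.
Implicit Types (K : set (set V)) (f : V -> R) (x : V) (t : nat).

Definition rational_linear_form f : Prop :=
  exists a : 'rV[rat]_d, forall x, f x = \sum_(i < d) ratr (a 0 i) * x 0 i.

Definition weight f : R := \sum_(i < d) f (delta_mx 0 i).

Definition integer_point x : Prop := forall i, x 0 i \is a Num.int.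

Definition open_cube (a b : R) : set V := [set x | forall i, a < x 0 i < b].
Definition closed_cube (a b : R) : set V := [set x | forall i, a <= x 0 i <= b].

Definition complement_of K : set V := ~` \bigcup_(h in K) h.

Definition closed_regions K : set (set V) :=
  [set closure (connected_component (complement_of K) y)
  | y in complement_of K].

Definition multiplicity K x : nat :=
  card [set C | closed_regions K C /\ C x].

(* The intersection poset. Reverse inclusion is the order of the dual type
   (set V)^d; the intersection over the empty subfamily is setT. *)
Definition flats K : set (set V)^d :=
  [set u | exists S : set (set V),
    [/\ S `<=` K, (u : set V) = \bigcap_(h in S) h & (u : set V) !=set0]].

Definition mobius_flats K (u : (set V)^d) : int :=
  mobius (flats K) (setT : set V) u.

Definition ehrhart (Q : set V) t : nat :=
  card (Q `&` [set t%:R^-1 *: z | z in integer_point]).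

(* Arrangements are sets of sets, so hyperplanes arising from several pairs
   j < k are counted once. *)
Definition arr_forms (m : nat) (f : 'I_m -> V -> R) : set (set V) :=
  [set h | exists j k : 'I_m, (j < k)%N /\ h = [set x : V | f j x = f k x]].

Definition arr_complete : set (set V) :=
  [set h | exists i j : 'I_d, (i < j)%N /\ h = [set x : V | x 0 i = x 0 j]].

Definition arr_all (m : nat) (f : 'I_m -> V -> R) : set (set V) :=
  arr_forms f `|` arr_complete.

Definition count_open (m : nat) (f : 'I_m -> V -> R) t : nat :=
  card [set x : V | [/\ integer_point x, open_cube 0 t%:R x
                  & injective (fun j => f j x)]].

Definition count_open_star (m : nat) (f : 'I_m -> V -> R) t : nat :=
  card [set x : V | [/\ integer_point x, open_cube 0 t%:R x,
                    injective (fun j => f j x) & injective (x 0)]].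

Definition count_closed (m : nat) (f : 'I_m -> V -> R) t : nat :=
  \sum_(x \in integer_point `&` closed_cube 0 t%:R)
    multiplicity (arr_forms f) x.

Definition count_closed_star (m : nat) (f : 'I_m -> V -> R) t : nat :=
  \sum_(x \in integer_point `&` closed_cube 0 t%:R)
    multiplicity (arr_all f) x.

End Arrangements.

(* Main.v *)
Require Import Defs.
From mathcomp Require Import all_boot all_order all_algebra.
From mathcomp Require Import finmap.
From mathcomp Require Import all_classical all_reals all_analysis.
From mathcomp Require Import lra.

(** All four formulas hold point by point. Every hyperplane involved is the
    kernel of a nonzero linear form, so every flat is a linear subspace and
    dilation by t turns E_(Q `&` u)(t) into the number of integer points of tQ
    lying in u. After exchanging the two summations it remains to show, for one
    point x and one central arrangement,

    - sum of mu(0,u) over the flats u containing x = 1 if x lies on no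
      hyperplane, and 0 otherwise;
    - sum of |mu(0,u)| over the flats u containing x = number of closed regions
      containing x.

    The first is the defining property of the Moebius function. The second is a
    local form of Zaslavsky's theorem. Both are read off one list of subspaces,
    [nbc W gs], which deletion and restriction produce: a form g that vanishes
    on W empties the list; otherwise the list for g :: gs is the list for gs on
    W followed by the list for gs on the kernel of g in W.

    Counted with the sign (-1)^codim, the members of the list containing a given
    set p cancel unless p lies in no hyperplane ([nbc_signed_count]). By
    uniqueness of the Moebius function ([mobius_unique]), mu(0,u) is the signed
    number of occurrences of u in the list. All occurrences of u have the sign
    of its codimension, hence |mu(0,u)| is the number of occurrences
    ([mobius_flats_normE]).

    Counted without sign, the members containing x are as many as the regions
    having x in their closure ([count_nbc]), because both numbers obey the same
    recursion: when h x = 0, a region of the remaining forms is cut in two by h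
    if it meets the kernel of h and stays one region otherwise
    ([receding_ncells_split]); when h x is not 0, only the side of h containing
    x matters ([receding_ncells_half]).

    Finally the topological regions are the sign cells of the forms
    ([cell_component]), and their closures are given by the weak inequalities
    ([closure_cell]); so distinct regions have distinct closures, and the
    multiplicity of x is the number of cells counted above
    ([multiplicity_hyps]). *)

Import Order.TTheory GRing.Theory Num.Theory.
Import numFieldNormedType.Exports.
Local Open Scope classical_set_scope.
Local Open Scope ring_scope.

Local Notation card := Defs.card.

(** * Linear forms, subspaces and the no-broken-circuit list *)

Section LinearForms.
Context {R : realType} {d : nat}.
Implicit Types (g h : 'cV[R]_d) (gs : seq 'cV[R]_d) (x y z : 'rV[R]_d).
Implicit Types (W U : 'M[R]_d) (p : set 'rV[R]_d).

Definition form g x : R := (x *m g) 0 0.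

Definition hyp g : set 'rV[R]_d := [set x | form g x = 0].

Definition subspace W : set 'rV[R]_d := [set x | (x <= W)%MS].

Lemma formD g x y : form g (x + y) = form g x + form g y.
Proof. by rewrite /form mulmxDl mxE. Qed.

Lemma formZ g a x : form g (a *: x) = a * form g x.
Proof. by rewrite /form -scalemxAl mxE. Qed.

Lemma formN g x : form (- g) x = - form g x.
Proof. by rewrite /form mulmxN mxE. Qed.

Lemma formNr g x : form g (- x) = - form g x.
Proof. by rewrite /form mulNmx mxE. Qed.

Lemma formB g h x : form (g - h) x = form g x - form h x.
Proof. by rewrite /form mulmxBr !mxE. Qed.

Lemma form_eq0 g x : (x *m g == 0) = (form g x == 0).
Proof.
apply/eqP/eqP => [xg|xg]; first by rewrite /form xg mxE.
by apply/matrixP => i j; rewrite !ord1 [RHS]mxE.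
Qed.

Lemma form_delta g i : form g (delta_mx 0 i) = g i 0.
Proof. by rewrite /form -rowE mxE. Qed.

Lemma hyp_neqT g : g != 0 -> hyp g <> setT.
Proof.
move=> /eqP g0 gT; apply: g0; apply/matrixP => i j.
rewrite ord1 -form_delta mxE.
by have : hyp g (delta_mx 0 i) by rewrite gT.
Qed.

Lemma subspace1 : subspace 1%:M = setT.
Proof. by apply/seteqP; split => x // _; exact: submx1. Qed.

Lemma subspace_cap_ker W g :
  subspace (W :&: kermx g)%MS = subspace W `&` hyp g.
Proof.
apply/seteqP; split => x; rewrite /subspace /= sub_capmx sub_kermx form_eq0.
  by move=> /andP[-> /eqP].
by move=> [-> /eqP].
Qed.

Lemma subspace_sub_hyp W g : W *m g == 0 -> subspace W `<=` hyp g.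
Proof.
by move=> Wg x /submx_trans xW; apply/eqP; rewrite -form_eq0 -sub_kermx xW // sub_kermx.
Qed.

Lemma form_neq0_ex W g : W *m g != 0 -> exists2 z, subspace W z & form g z != 0.
Proof.
apply: contraNP => nz; apply/eqP/row_matrixP => i; rewrite row0 row_mul.
apply/eqP; rewrite form_eq0; apply: contrapT => /negP ng.
by apply: nz; exists (row i W) => //; exact: row_sub.
Qed.

Lemma subspace_rank W U : subspace W = subspace U -> \rank W = \rank U.
Proof.
have sub W1 W2 : subspace W1 `<=` subspace W2 -> (W1 <= W2)%MS.
  by move=> s; apply/row_subP => i; apply: (s (row i W1)); exact: row_sub.
by move=> WU; apply/eqmx_rank/andP; split; apply: sub; rewrite WU.
Qed.

Lemma rank_cap_ker W g : W *m g != 0 ->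
  \rank W = (\rank (W :&: kermx g)%MS).+1.
Proof.
move=> Wg; rewrite -(mxrank_mul_ker W g).
have := rank_leq_col (W *m g); rewrite -mxrank_eq0 in Wg.
by case: (\rank _) Wg => [//|[|//]] _ _.
Qed.

(** Whitney's no-broken-circuit expansion. A recursion branch that survives to
    the end corresponds to a subset S of gs, the forms whose kernels were cut
    out, containing no circuit deprived of its last element; the branch
    contributes the flat cut out by S. Flats occur with multiplicity. *)
Fixpoint nbc W gs : seq 'M[R]_d :=
  if gs is g :: gs' then
    if W *m g == 0 then [::] else nbc W gs' ++ nbc (W :&: kermx g)%MS gs'
  else [:: W].

Lemma nbc_sub W gs U : U \in nbc W gs -> subspace U `<=` subspace W.
Proof.
elim: gs W => [|g gs IH] W /=; first by rewrite inE => /eqP ->.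
case: ifP => // _; rewrite mem_cat => /orP[/IH //|/IH].
by rewrite subspace_cap_ker => /subset_trans; apply => x [].
Qed.

Lemma nbc_flat W gs U : U \in nbc W gs ->
  exists S : set (set 'rV[R]_d), S `<=` [set hyp g | g in [set` gs]] /\
    subspace U = subspace W `&` \bigcap_(h in S) h.
Proof.
elim: gs W => [|g gs IH] W /=.
  by rewrite inE => /eqP ->; exists set0; split => //; rewrite bigcap_set0 setIT.
case: ifP => // _; rewrite mem_cat => /orP[] /IH[S [SK ->]].
  exists S; split => // h /SK [g' /= g'gs <-].
  by exists g' => //=; rewrite inE g'gs orbT.
exists (hyp g |` S); split.
  move=> h [->|/SK [g' /= g'gs <-]]; first by exists g => //=; rewrite inE eqxx.
  by exists g' => //=; rewrite inE g'gs orbT.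
by rewrite bigcap_setU bigcap_set1 subspace_cap_ker setIA.
Qed.

(** If p lies in the kernel of g, the two halves of the list have opposite
    signs, as cutting by g lowers the rank by one, and cancel; otherwise no
    member of the second half contains p. *)
Lemma nbc_signed_count p W gs : p `<=` subspace W ->
  \sum_(U <- nbc W gs | `[< p `<=` subspace U >]) (-1) ^+ (\rank W + \rank U)
  = (all (fun g => ~~ `[< p `<=` hyp g >]) gs)%:R :> int.
Proof.
elim: gs W => [|g gs IH] W pW /=.
  by rewrite big_cons big_nil asboolT // addr0 addnn -signr_odd odd_double.
case: ifPn => [Wg|Wg].
  by rewrite big_nil asboolT //; apply: subset_trans (subspace_sub_hyp _ _ Wg).
rewrite big_cat /= IH //.
have rkW := rank_cap_ker _ _ Wg.
case: asboolP => [ph|nph] /=.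
  transitivity ((all (fun g => ~~ `[< p `<=` hyp g >]) gs)%:R
    - (all (fun g => ~~ `[< p `<=` hyp g >]) gs)%:R : int); last by rewrite subrr.
  congr (_ + _); rewrite -(IH (W :&: kermx g)%MS); last first.
    by rewrite subspace_cap_ker => x px; split; [exact: pW|exact: ph].
  rewrite -sumrN; apply: eq_bigr => U _.
  by rewrite rkW addSn exprS mulN1r.
rewrite [X in _ + X]big1_seq ?addr0 // => U /andP[/asboolP pU /nbc_sub].
rewrite subspace_cap_ker => s.
by exfalso; apply: nph => x /pU /s [].
Qed.

End LinearForms.

(** * Counting regions by deletion and restriction *)

Section Regions.
Context {R : realType} {d : nat}.
Local Notation V := 'rV[R]_d.
Implicit Types (g h : 'cV[R]_d) (gs : seq 'cV[R]_d) (x y z : V).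
Implicit Types (W U : 'M[R]_d) (C D : set V).

Definition half h : set V := [set z | 0 < form h z].

Definition cell gs y : set V :=
  [set z | {in gs, forall g, 0 < form g z * form g y}].

(** The regions of gs within C that have x in their closure: the weak
    inequalities on x express adherence to the cell of y. *)
Definition regions_at C gs x : set (set V) :=
  [set D | exists y, [/\ C y,
     {in gs, forall g, form g y != 0 /\ 0 <= form g x * form g y} &
     D = C `&` cell gs y]].

Lemma regions_at_nil C x :
  regions_at C [::] x = if `[< C !=set0 >] then [set C] else set0.
Proof.
have cellT y : cell [::] y = setT by apply/seteqP; split.
apply/seteqP; split => D.
  move=> [y [Cy _ ->]]; rewrite asboolT; last by exists y.
  by rewrite cellT setIT.
by case: asboolP => // -[y Cy] ->; exists y; split; rewrite // cellT setIT.
Qed.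

Lemma cell_cons h gs y : 0 < form h y -> cell (h :: gs) y = half h `&` cell gs y.
Proof.
move=> hy; apply/seteqP; split => z.
  move=> cz; split; last by move=> g ggs; apply: cz; rewrite inE ggs orbT.
  by have := cz h (mem_head _ _); rewrite pmulr_lgt0.
by move=> [hz cz] g; rewrite inE => /orP[/eqP ->|/cz //]; rewrite mulr_gt0.
Qed.

Lemma cell_oppr h gs y : cell (- h :: gs) y = cell (h :: gs) y.
Proof.
apply/seteqP; split => z cz g; rewrite inE => /orP[/eqP ->|ggs].
- by have := cz _ (mem_head _ _); rewrite !formN mulrNN.
- by apply: cz; rewrite inE ggs orbT.
- by have := cz _ (mem_head _ _); rewrite !formN mulrNN.
- by apply: cz; rewrite inE ggs orbT.
Qed.

Lemma regions_at_oppr C h gs x :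
  regions_at C (- h :: gs) x = regions_at C (h :: gs) x.
Proof.
apply/seteqP; split => D [y [Cy sy ->]]; exists y;
  (split => //; last by rewrite cell_oppr);
  move=> g; rewrite inE => /orP[/eqP ->|ggs];
  try by apply: sy; rewrite inE ggs orbT.
- by have := sy _ (mem_head _ _); rewrite !formN mulrNN oppr_eq0.
- by have := sy _ (mem_head _ _); rewrite !formN mulrNN oppr_eq0.
Qed.

Lemma regions_at_half_sub C h gs x : 0 <= form h x ->
  regions_at (C `&` half h) gs x `<=` regions_at C (h :: gs) x.
Proof.
move=> hx D [y [[Cy hy] sy ->]]; exists y; split=> //.
  move=> g; rewrite inE => /orP[/eqP ->|/sy //].
  by rewrite gt_eqF // mulr_ge0 // ltW.
by rewrite cell_cons // setIA.
Qed.

(** A region with x in its closure lies on a side of h whose closure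
    contains x. *)
Lemma regions_at_cons C h gs x : regions_at C (h :: gs) x =
  (if 0 <= form h x then regions_at (C `&` half h) gs x else set0) `|`
  (if 0 <= form (- h) x then regions_at (C `&` half (- h)%R) gs x else set0).
Proof.
apply/seteqP; split => D; last first.
  case=> [|]; case: ifP => // hx /(regions_at_half_sub _ _ _ _ hx); first by [].
  by rewrite regions_at_oppr.
move=> [y [Cy sy ->]].
have [hy0 hxy] := sy h (mem_head _ _).
have sgs : {in gs, forall g, form g y != 0 /\ 0 <= form g x * form g y}.
  by move=> g ggs; apply: sy; rewrite inE ggs orbT.
have [hy|hy|hy] := ltgtP 0 (form h y); last by rewrite -hy eqxx in hy0.
- left; rewrite -(pmulr_lge0 _ hy) hxy.
  by exists y; split => //; rewrite cell_cons // setIA.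
- have nhy : 0 < form (- h) y by rewrite formN oppr_gt0.
  right; rewrite -(pmulr_lge0 _ nhy) !formN mulrNN hxy.
  by exists y; split => //; rewrite -cell_oppr cell_cons // setIA.
Qed.

Lemma regions_at_finite C gs x : finite_set (regions_at C gs x).
Proof.
elim: gs C => [|h gs IH] C.
  by rewrite regions_at_nil; case: ifP => _; [exact: finite_set1|].
by rewrite regions_at_cons finite_setU; split; case: ifP.
Qed.

Lemma regions_at_sub C gs x D : regions_at C gs x D -> D !=set0 /\ D `<=` C.
Proof.
move=> [y [Cy sy ->]]; split; last by move=> z [].
by exists y; split => // g /sy[gy _]; rewrite -expr2 exprn_even_gt0.
Qed.

Definition ncells C gs x : nat := card (regions_at C gs x).

Lemma ncells_nil C x : ncells C [::] x = `[< C !=set0 >].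
Proof.
rewrite /ncells /card regions_at_nil; case: asboolP => _.
  by rewrite fset_set1 cardfs1.
by rewrite fset_set0 cardfs0.
Qed.

Lemma ncells_cons C h gs x : ncells C (h :: gs) x =
  ((0 <= form h x)%R * ncells (C `&` half h) gs x +
   (0 <= form (- h) x)%R * ncells (C `&` half (- h)%R) gs x)%N.
Proof.
rewrite /ncells regions_at_cons /card.
have fin (b : bool) C' : finite_set (if b then regions_at C' gs x else set0).
  by case: b => //; exact: regions_at_finite.
rewrite fset_setU // cardfsU [X in (_ - X)%N](_ : _ = 0%N) ?subn0; last first.
  rewrite -fset_setI // [X in fset_set X](_ : _ = set0) ?fset_set0 ?cardfs0 //.
  rewrite -subset0 => D []; case: ifP => // _; case: ifP => // _.
  move=> /regions_at_sub[_ s1] /regions_at_sub[[y Dy] s2].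
  have [_] := s1 y Dy; have [_] := s2 y Dy.
  by rewrite /half /= formN oppr_gt0 => /ltW; rewrite leNgt => /negbTE ->.
by congr (_ + _)%N; case: ifP; rewrite ?mul1n // fset_set0 cardfs0.
Qed.

Lemma ncells_eq0 C gs x g : g \in gs -> C `<=` hyp g -> ncells C gs x = 0%N.
Proof.
move=> ggs Cg; rewrite /ncells /card [X in fset_set X](_ : _ = set0).
  by rewrite fset_set0 cardfs0.
rewrite -subset0 => D [y [/Cg gy /(_ g ggs)[+ _] _]].
by rewrite gy eqxx.
Qed.

(** C is convex, relatively open in the directions of W, and x is a recession
    direction of it. These are the properties of the cells met along the
    recursion that its geometric steps use, and they are inherited by the parts
    of C on the sides of a hyperplane to which x adheres. *)
Record receding W x C : Prop := Receding {
  receding_segment : forall y z s, C y -> C z -> 0 <= s <= 1 ->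
    C (y + s *: (z - y));
  receding_open : forall y z, C y -> subspace W z ->
    exists2 e, 0 < e & forall s, 0 <= s <= e -> C (y + s *: z);
  receding_ray : forall y s, C y -> 0 <= s -> C (y + s *: x) }.

Lemma receding_subspace W x : subspace W x -> receding W x (subspace W).
Proof.
move=> Wx; split.
- by move=> y z s Wy Wz _; rewrite /subspace /= addmx_sub // scalemx_sub //
  addmx_sub // eqmx_opp.
- by move=> y z Wy Wz; exists 1 => // s _; rewrite /subspace /= addmx_sub // scalemx_sub.
- by move=> y s Wy _; rewrite /subspace /= addmx_sub // scalemx_sub.
Qed.

(** The sign condition on x serves only to keep it a recession direction. *)
Lemma receding_half W x C h : receding W x C -> 0 <= form h x ->
  receding W x (C `&` half h).
Proof.
move=> [seg opn ray] hx; split.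
- move=> y z s [Cy hy] [Cz hz] s01; split; first exact: seg.
  rewrite /half /= in hy hz *; move/andP: s01 => [s0 s1].
  rewrite formD formZ formD formNr.
  (* Whichever of the weights 1 - s and s is nonzero gives strictness. *)
  have [sh|sh] := ltP s (1 / 2).
    have : 0 <= s * form h z by rewrite mulr_ge0 // ltW.
    have : 0 < (1 - s) * form h y by rewrite mulr_gt0 //; lra.
    by nra.
  have : 0 <= (1 - s) * form h y by rewrite mulr_ge0 ?subr_ge0 // ltW.
  have : 0 < s * form h z by rewrite mulr_gt0 //; lra.
  by nra.
- move=> y z [Cy hy] Wz; have [e e0 He] := opn y z Cy Wz.
  have b0 : 0 < `|form h z| + 1 by rewrite ltr_wpDl.
  (* Below the second bound, |s * form h z| is smaller than form h y. *)
  exists (Num.min e (form h y / (`|form h z| + 1))).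
    by rewrite lt_min e0 divr_gt0.
  move=> s /andP[s0]; rewrite le_min => /andP[se]; rewrite ler_pdivlMr // => sb.
  split; first by apply: He; rewrite s0 se.
  rewrite /half /= in hy *; rewrite formD formZ.
  have := ler_norm (- form h z); rewrite normrN => hzn.
  have [->|sn0] := eqVneq s 0; first by rewrite mul0r addr0.
  have sp : 0 < s by rewrite lt_neqAle eq_sym sn0.
  by nra.
- move=> y s [Cy hy] s0; split; first exact: ray.
  by rewrite /half /= formD formZ ltr_wpDr // mulr_ge0.
Qed.

(** Far enough in the direction of x, every point of C enters the half-space,
    so restricting to it loses no region. *)
Lemma receding_ncells_half W x C h gs : receding W x C -> 0 < form h x ->
  ncells (C `&` half h) gs x = ncells C gs x.
Proof.
move=> + hx; elim: gs C => [|g gs IH] C sC.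
  rewrite !ncells_nil; congr (nat_of_bool _); apply/asboolP/asboolP.
    by move=> [y []]; exists y.
  move=> [y Cy].
  exists (y + ((`|form h y| + 1) / form h x) *: x); split.
    by apply: receding_ray sC _ _ Cy _; rewrite divr_ge0 ?addr_ge0 // ltW.
  rewrite /half /= formD formZ divfK ?gt_eqF //.
  have := ler_norm (- form h y); rewrite normrN; lra.
rewrite !ncells_cons ![C `&` half h `&` _]setIAC.
by congr (_ + _)%N; case: (leP 0) => gx; rewrite ?mul0n // IH //; exact: receding_half.
Qed.

(** The count of regions behaves like a valuation: by induction on the forms it
    reduces to the case without forms, where it says that a nonempty C meets
    both sides of h exactly when it meets the hyperplane. Convexity gives one direction and
    relative openness the other. *)
Lemma receding_ncells_split W x C h gs :
    receding W x C -> W *m h != 0 -> form h x = 0 ->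
  (ncells (C `&` half h) gs x + ncells (C `&` half (- h)%R) gs x =
   ncells C gs x + ncells (C `&` hyp h) gs x)%N.
Proof.
move=> + Wh hx; elim: gs C => [|g gs IH] C sC.
  rewrite !ncells_nil.
  have [v Wv hv] : exists2 v, subspace W v & 0 < form h v.
    have [v Wv] := form_neq0_ex _ _ Wh; rewrite neq_lt => /orP[hv|hv].
      exists (- v); first by rewrite /subspace /= eqmx_opp.
      by rewrite formNr oppr_gt0.
    by exists v.
  have Wnv : subspace W (- v) by rewrite /subspace /= eqmx_opp.
  have perturb : C `&` hyp h !=set0 -> C `&` half h !=set0 /\ C `&` half (- h)%R !=set0.
    move=> [y [Cy hy]].
    have [e e0 He] := receding_open _ _ _ sC y v Cy Wv.
    have [e' e0' He'] := receding_open _ _ _ sC y (- v) Cy Wnv.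
    split; [exists (y + e *: v)|exists (y + e' *: - v)].
      split; first by apply: He; rewrite lexx ltW.
      by rewrite /half /= formD formZ hy add0r mulr_gt0.
    split; first by apply: He'; rewrite lexx ltW.
    by rewrite /half /= formN formD formZ hy add0r formNr mulrN opprK mulr_gt0.
  have cross : C `&` half h !=set0 -> C `&` half (- h)%R !=set0 -> C `&` hyp h !=set0.
    move=> [y [Cy]]; rewrite /half /= => hy [z [Cz]]; rewrite /= formN oppr_gt0 => hz.
    have dn0 : 0 < form h y - form h z by lra.
    exists (y + (form h y / (form h y - form h z)) *: (z - y)); split.
      apply: receding_segment sC _ _ _ Cy Cz _.
      by rewrite ler_pdivrMr // mul1r divr_ge0 /=; lra.
    rewrite /hyp /= formD formZ formD formNr.
    by rewrite -[form h z - _]opprB mulrN divfK ?gt_eqF // subrr.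
  have nonempty : C !=set0 <->
      C `&` half h !=set0 \/ C `&` half (- h)%R !=set0 \/ C `&` hyp h !=set0.
    split; last by case=> [|[]] [y [Cy _]]; exists y.
    move=> [y Cy]; have [hy|hy|hy] := ltgtP 0 (form h y).
    - by left; exists y.
    - by right; left; exists y; split => //; rewrite /half /= formN oppr_gt0.
    - by right; right; exists y.
  case: (asboolP (C `&` half h !=set0)) => P;
  case: (asboolP (C `&` half (- h)%R !=set0)) => N;
  case: (asboolP (C `&` hyp h !=set0)) => Z;
  case: (asboolP (C !=set0)) => E //; exfalso; tauto.
rewrite !ncells_cons ![C `&` half h `&` _]setIAC ![C `&` half (- h)%R `&` _]setIAC.
rewrite ![C `&` hyp h `&` _]setIAC addnACA [RHS]addnACA -!mulnDr.
by congr (_ + _)%N; case: (leP 0) => gx; rewrite ?mul0n // IH //; exact: receding_half.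
Qed.

(** The local form of Zaslavsky's theorem. Away from the kernel of h the second
    half of the list has no member through x, matching the fact that only one
    side of h adheres to x; on the kernel both halves count. *)
Lemma count_nbc W gs x : subspace W x ->
  count (fun U => (x <= U)%MS) (nbc W gs) = ncells (subspace W) gs x.
Proof.
elim: gs W => [|h gs IH] W Wx /=.
  by rewrite ncells_nil asboolT; [rewrite addn0; congr nat_of_bool|exists x].
case: ifPn => [Wh|Wh].
  by rewrite (ncells_eq0 _ _ _ h) ?mem_head //; exact: subspace_sub_hyp.
rewrite count_cat ncells_cons IH //.
have sW := receding_subspace _ _ Wx.
have none : form h x != 0 ->
    count (fun U => (x <= U)%MS) (nbc (W :&: kermx h)%MS gs) = 0%N.
  move=> hx; apply/eqP; rewrite -leqn0 leqNgt -has_count; apply/hasPn => U.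
  move/nbc_sub => sU; apply/negP => /sU; rewrite subspace_cap_ker => -[_].
  by apply/eqP.
have [hx|hx|hx] := ltgtP 0 (form h x).
- rewrite none ?gt_eqF // formN oppr_ge0 leNgt hx mul0n !addn0 mul1n.
  by rewrite (receding_ncells_half _ _ _ _ _ sW).
- rewrite none ?lt_eqF // formN oppr_ge0 ltW // mul0n addn0 mul1n add0n.
  by rewrite (receding_ncells_half _ _ _ _ _ sW) // formN oppr_gt0.
- rewrite formN -hx oppr0 lexx !mul1n (receding_ncells_split _ _ _ _ _ sW) //.
  by congr (_ + _)%N; rewrite IH subspace_cap_ker.
Qed.

End Regions.

(** * Topological regions are sign cells *)

Section Topology.
Context {R : realType} {d : nat}.
Local Notation V := 'rV[R]_d.
Implicit Types (g h : 'cV[R]_d) (gs : seq 'cV[R]_d) (x y z : V).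

Definition hyps gs : set (set V) := [set hyp g | g in [set` gs]].

Lemma complement_hyps gs :
  complement_of (hyps gs) = [set y | {in gs, forall g, form g y != 0}].
Proof.
apply/seteqP; split => y.
  move=> ny g ggs; apply/eqP => gy; apply: ny.
  by exists (hyp g) => //; exists g.
by move=> sy [_ [g /= ggs <-] /eqP]; apply/negP/sy.
Qed.

Lemma form_continuous g : continuous (form g : V -> R).
Proof.
rewrite (_ : form g = fun x => \sum_i x 0 i * g i 0); last first.
  by apply/funext => x; rewrite /form mxE.
apply: continuous_big; first exact: add_continuous.
by move=> i _ x; apply: continuousM; [exact: coord_continuous|exact: cst_continuous].
Qed.

Lemma line_continuous y z : continuous (fun s : R => y + s *: z).
Proof.
move=> s; apply: cvgD; first exact: cvg_cst.
exact: scalel_continuous.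
Qed.

Lemma segment_rV_connected y z : connected [set y + s *: (z - y) | s in `[0, 1 : R]].
Proof.
apply: connected_continuous_connected; first exact: segment_connected.
by apply: continuous_subspaceT; exact: line_continuous.
Qed.

Lemma cell_refl gs y : {in gs, forall g, form g y != 0} -> cell gs y y.
Proof. by move=> sy g /sy gy; rewrite -expr2 exprn_even_gt0. Qed.

(** A form has no zero on a connected subset of the complement, so by the
    intermediate value property its sign is constant there; conversely a cell is
    convex, and the segment from y to any of its points is connected. *)
Lemma cell_component gs y : {in gs, forall g, form g y != 0} ->
  connected_component (complement_of (hyps gs)) y = cell gs y.
Proof.
move=> sy; rewrite complement_hyps; apply/seteqP; split => z.
  move=> [B [By BK Bc] Bz] g ggs.
  have gBc : connected [set form g x | x in B].
    apply: connected_continuous_connected => //.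
    by apply: continuous_subspaceT; exact: form_continuous.
  have {}gBc := (connected_intervalP _).1 gBc.
  have nz a b : B a -> B b -> form g a < 0 -> 0 < form g b -> False.
    move=> Ba Bb ga gb.
    have [x Bx gx] : [set form g x | x in B] 0.
      apply: (gBc (form g a) (form g b)); [by exists a|by exists b|].
      by rewrite !ltW.
    by have := BK _ Bx _ ggs; rewrite gx eqxx.
  have := BK _ By _ ggs; have := BK _ Bz _ ggs.
  rewrite !neq_lt => /orP[gz|gz] /orP[gy|gy].
  - by rewrite nmulr_rgt0.
  - by have := nz z y Bz By gz gy.
  - by have := nz y z By Bz gy gz.
  - by rewrite mulr_gt0.
move=> cz; exists [set y + s *: (z - y) | s in `[0, 1 : R]]; last first.
  by exists 1; [rewrite /= in_itv /= ler01 lexx|rewrite scale1r addrC subrK].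
split; last exact: segment_rV_connected.
  by exists 0; [rewrite /= in_itv /= ler01 lexx|rewrite scale0r addr0].
move=> _ [s + <-] g ggs; rewrite /= in_itv /= => /andP[s0 s1].
have gz := cz g ggs; have gy := cell_refl _ _ sy g ggs.
rewrite -(@mulrI_eq0 _ (form g y)); last by apply/mulfI/sy.
rewrite formD formZ formD formNr gt_eqF //.
have [sh|sh] := ltP s (1 / 2); nra.
Qed.

(** If x satisfies the weak inequalities, the points x + s y with small s > 0 lie
    in the cell and tend to x. *)
Lemma closure_cell gs y : {in gs, forall g, form g y != 0} ->
  closure (cell gs y) =
  [set x | {in gs, forall g, 0 <= form g x * form g y}].
Proof.
move=> sy; apply/seteqP; split => x.
  move=> cx g ggs.
  pose F x := form g x * form g y.
  have cF : continuous F.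
    by move=> z; apply: continuousM; [exact: form_continuous|exact: cst_continuous].
  have clF : closed [set x | 0 <= F x].
    exact: (continuous_closedP _).1 cF _ (@closed_ge _ 0).
  have s : cell gs y `<=` [set x | 0 <= F x] by move=> z /(_ g ggs) /ltW.
  by have := closureS s cx; rewrite -(closure_id _).1.
move=> gx B Bx.
have : \forall s \near 0^'+, B (x + s *: y).
  apply: (cvg_at_right_filter (line_continuous x y 0)).
  by rewrite scale0r addr0.
move=> nB; near (0 : R)^'+ => s.
exists (x + s *: y); split; last by near: s.
move=> g ggs; rewrite formD formZ mulrDl -mulrA ltr_wpDl ?gx //.
by rewrite mulr_gt0 //; exact: (cell_refl _ _ sy g ggs).
Unshelve. all: by end_near.
Qed.

(** Closed regions are counted as sets, so the point is that closure is
    injective on cells: y in the closure of the cell of y' satisfies the weak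
    inequalities of that cell and, lying on no hyperplane, the strict ones. *)
Lemma multiplicity_hyps gs x : multiplicity (hyps gs) x = ncells setT gs x.
Proof.
rewrite /multiplicity /ncells /card.
rewrite (_ : [set C | _] = [set closure D | D in regions_at setT gs x]); last first.
  apply/seteqP; split => C.
    move=> [[y]]; rewrite complement_hyps => sy <-; rewrite -complement_hyps.
    rewrite cell_component // => cx; exists (cell gs y) => //.
    exists y; split; rewrite ?setTI // => g ggs.
    by split; [exact: sy|move: cx; rewrite closure_cell //; apply].
  move=> [_ [y [_ sy ->]] <-]; rewrite setTI.
  have sy1 : {in gs, forall g, form g y != 0} by move=> g /sy [].
  split; last by rewrite closure_cell // => g /sy [].
  by exists y; [rewrite complement_hyps|rewrite cell_component].
rewrite fset_set_image; last exact: regions_at_finite.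
rewrite card_in_imfset // => D D'.
rewrite !in_fset_set; [|exact: regions_at_finite|exact: regions_at_finite].
move=> /set_mem [y [_ sy ->]] /set_mem [y' [_ sy' ->]]; rewrite !setTI.
have {}sy : {in gs, forall g, form g y != 0} by move=> g /sy [].
have {}sy' : {in gs, forall g, form g y' != 0} by move=> g /sy' [].
move=> clE.
have : closure (cell gs y') y by rewrite -clE; apply: subset_closure; exact: cell_refl.
rewrite closure_cell // => yy'.
have pos g : g \in gs -> 0 < form g y * form g y'.
  by move=> ggs; rewrite lt_neqAle yy' // andbT eq_sym mulf_neq0 ?sy ?sy'.
apply/seteqP; split => z cz g ggs; have := cz g ggs; have := pos g ggs.
- by move=> p q; have := mulr_gt0 p q; have := cell_refl _ _ sy g ggs; nra.
- by move=> p q; have := mulr_gt0 p q; have := cell_refl _ _ sy' g ggs; nra.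
Qed.

End Topology.

(** * The Moebius function of the intersection poset *)

(** The values sum to 0 over every nontrivial interval starting at r, which is
    the recursion that determines the Moebius function. *)
Lemma mobius_unique {disp : Order.disp_t} {T : porderType disp} (P : set T)
    (r : T) (M : T -> int) : finite_set P ->
    (forall s, P s -> (r <= s)%O ->
      \sum_(u \in P `&` [set u | (r <= u <= s)%O]) M u = (s == r)%:R) ->
  forall s, P s -> (r <= s)%O -> mobius P r s = M s.
Proof.
move=> finP sumM.
pose I s := P `&` [set u | (r <= u < s)%O].
have finI v : finite_set (I v) by apply: sub_finite_set finP => x [].
have IE s : P s -> (r <= s)%O ->
    P `&` [set u | (r <= u <= s)%O] = s |` I s.
  move=> Ps rs; apply/seteqP; split => u.
    move=> [Pu /= /andP[ru]]; rewrite le_eqVlt => /orP[/eqP ->|us]; first by left.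
    by right; split => //=; rewrite ru.
  by move=> [->|[Pu /= /andP[ru us]]]; split => //=; rewrite ?rs ?lexx // ru ltW.
have sumE s : P s -> (r <= s)%O -> M s + \sum_(u \in I s) M u = (s == r)%:R.
  move=> Ps rs; rewrite -sumM // IE // fsbigU0 ?fsbig_set1 //.
  by move=> u [/= -> [_ /= /andP[_]]]; rewrite ltxx.
have Icard u v : I v u -> (card (I u) < card (I v))%N.
  move=> [Pu /= /andP[ru uv]]; apply: fproper_ltn_card.
  rewrite fproperE; apply/andP; split.
    apply/fsubsetP => x; rewrite !in_fset_set // => /set_mem[Px /= /andP[rx xu]].
    by apply/mem_set; split=> //=; rewrite rx (lt_trans xu uv).
  apply/fsubsetPn; exists u; rewrite in_fset_set //.
    by apply/mem_set; split=> //=; rewrite ru.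
  by apply/negP => /set_mem[_ /= /andP[_]]; rewrite ltxx.
suff main k : forall s, P s -> (r <= s)%O -> (card (I s) < k)%N -> mobius P r s = M s.
  by move=> s Ps rs; exact: main (ltnSn _).
elim: k => // k IH s Ps rs ck; have := sumE s Ps rs.
move: rs; rewrite le_eqVlt => /orP[/eqP rs|rs].
  rewrite -rs mobius_id eqxx (_ : I r = set0) ?fsbig_set0 ?addr0 //.
  by rewrite -subset0 => u [_ /= /andP[ru /(le_lt_trans ru)]]; rewrite ltxx.
rewrite gt_eqF // => /eqP; rewrite addr_eq0 => /eqP ->.
rewrite mobius_lt //; congr (- _); apply: eq_fsbigr => u /set_mem Iu.
case: (Iu) => Pu /= /andP[ru _]; apply: IH => //.
by apply: leq_trans (Icard _ _ Iu) _.
Qed.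

Section FlatSums.
Context {R : realType} {d : nat}.
Local Notation V := 'rV[R]_d.
Variable gs : seq 'cV[R]_d.
Implicit Types (g : 'cV[R]_d) (x : V) (U : 'M[R]_d).

Lemma flats_finite : finite_set (flats (hyps gs)).
Proof.
pose F (A : {set 'I_(size gs)}) : (set V)^d :=
  \bigcap_(i in [set` A]) hyp (nth 0 gs i).
apply: (sub_finite_set (B := [set F A | A in setT])); last first.
  by apply: finite_image; exact: finite_finset.
move=> u [S [SK uE _]].
exists [set i : 'I_(size gs) | `[< S (hyp (nth 0 gs i)) >]]%SET => //.
rewrite [RHS]uE /F; apply/seteqP; split => x xF.
  move=> h Sh; have [g /= ggs gh] := SK h Sh.
  have gi : (index g gs < size gs)%N by rewrite index_mem.
  have := xF (Ordinal gi); rewrite /= inE /= nth_index // gh; apply.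
  exact/asboolP.
by move=> i /=; rewrite inE => /asboolP /xF.
Qed.

Lemma nbc_flats U : U \in nbc 1%:M gs -> flats (hyps gs) (subspace U).
Proof.
move=> /nbc_flat[S [SK UE]]; exists S; split => //.
  by rewrite UE subspace1 setTI.
by exists 0; rewrite /subspace /= sub0mx.
Qed.

(** Every member of the list is a flat, so grouping the list by flats loses
    nothing. *)
Lemma sum_flats_nbc (phi : set V -> int) (c : 'M[R]_d -> int) :
  \sum_(u \in flats (hyps gs))
    phi u * \sum_(U <- nbc 1%:M gs | subspace U == u) c U =
  \sum_(U <- nbc 1%:M gs) phi (subspace U) * c U.
Proof.
rewrite fsbig_finite; last exact: flats_finite.
under eq_bigr do rewrite mulr_sumr.
rewrite (exchange_big_dep xpredT) //=; apply: eq_big_seq => U Unbc.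
rewrite -big_filter (_ : [seq _ <- _ | _] = [:: subspace U : (set V)^d]) ?big_seq1 //.
rewrite (eq_filter (a2 := pred1 (subspace U : (set V)^d)));
  last by move=> v; rewrite /= eq_sym.
rewrite filter_pred1_uniq ?fset_uniq // in_fset_set; last exact: flats_finite.
exact/mem_set/nbc_flats.
Qed.

Hypothesis gs_neq0 : {in gs, forall g, g != 0}.

(** A flat other than the whole space is the intersection of a nonempty family
    of hyperplanes, and the whole space lies in none, the forms being nonzero. *)
Lemma flat_generic u : flats (hyps gs) u ->
  all (fun g => ~~ `[< (u : set V) `<=` hyp g >]) gs = (u == (setT : set V)).
Proof.
move=> [S [SK uE _]]; apply/idP/eqP => [/allP uS|->].
  rewrite uE; suff -> : S = set0 by rewrite bigcap_set0.
  rewrite -subset0 => h Sh; have [g /= ggs gh] := SK h Sh.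
  have /negP := uS g ggs; apply; apply/asboolP.
  by rewrite gh uE; exact: bigcap_inf.
apply/allP => g ggs; apply/negP => /asboolP gT.
by apply: (hyp_neqT _ (gs_neq0 _ ggs)); apply/seteqP; split.
Qed.

Lemma mobius_flatsE u : flats (hyps gs) u ->
  mobius_flats (hyps gs) u =
  \sum_(U <- nbc 1%:M gs | subspace U == u) (-1) ^+ (d + \rank U).
Proof.
move=> fu; rewrite /mobius_flats.
have leT (v : (set V)^d) : ((setT : set V) <= v :> (set V)^d)%O.
  by rewrite leEdual subsetEset.
apply: (mobius_unique _ _ (fun u : (set V)^d =>
  \sum_(U <- nbc 1%:M gs | subspace U == u) (-1) ^+ (d + \rank U))) => //.
  exact: flats_finite.
move=> s fs _; rewrite -flat_generic // -(nbc_signed_count _ 1%:M); last first.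
  by rewrite subspace1.
rewrite fsbig_mkcondr mxrank1.
transitivity (\sum_(U <- nbc 1%:M gs) (`[< (s : set V) `<=` subspace U >])%:R *
    (-1) ^+ (d + \rank U) : int); last first.
  rewrite [RHS]big_mkcond; apply: eq_bigr => U _.
  by case: asboolP => _; rewrite ?mul1r ?mul0r.
rewrite -(sum_flats_nbc (fun v => (`[< (s : set V) `<=` v >])%:R)).
apply: eq_fsbigr => v _.
rewrite mem_setE [X in if X then _ else _](_ : _ = `[< (s : set V) `<=` v >]); last first.
  by rewrite -[LHS]/(_ <= v <= s)%O leT leEdual; apply/subsetPset/asboolP.
by case: asboolP => _; rewrite ?mul1r ?mul0r.
Qed.

(** The sign depends on the rank only, so no cancellation occurs among the
    occurrences of one flat. *)
Lemma mobius_flats_normE u : flats (hyps gs) u ->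
  `|mobius_flats (hyps gs) u| = \sum_(U <- nbc 1%:M gs | subspace U == u) 1.
Proof.
move=> fu; rewrite mobius_flatsE //.
case: (pselect (exists U, subspace U = u)) => [[U0 U0u]|nu]; last first.
  by rewrite !big1 ?normr0 // => U /eqP Uu; case: nu; exists U.
transitivity `|(-1) ^+ (d + \rank U0) *
    \sum_(U <- nbc 1%:M gs | subspace U == u) 1 : int|.
  congr `| _ |; rewrite mulr_sumr; apply: eq_bigr => U /eqP Uu.
  by rewrite mulr1 (subspace_rank U U0) // U0u.
by rewrite normrM normrX normrN1 expr1n mul1r ger0_norm // sumr_ge0.
Qed.

Lemma sum_mobius_flats x :
  \sum_(u \in flats (hyps gs)) mobius_flats (hyps gs) u * (`[< (u : set V) x >])%:R
  = (`[< complement_of (hyps gs) x >])%:R.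
Proof.
under eq_fsbigr => u /set_mem fu do rewrite mobius_flatsE // mulrC.
rewrite (sum_flats_nbc (fun u => (`[< u x >])%:R)).
transitivity (\sum_(U <- nbc 1%:M gs | `[< [set x] `<=` subspace U >])
    (-1) ^+ (\rank (1%:M : 'M[R]_d) + \rank U) : int).
  rewrite [RHS]big_mkcond mxrank1; apply: eq_bigr => U _.
  rewrite (_ : [set x] `<=` _ = subspace U x); last by rewrite sub1set inE.
  by case: asboolP; rewrite ?mul1r ?mul0r.
rewrite nbc_signed_count ?subspace1 //; congr (nat_of_bool _)%:R.
rewrite complement_hyps; apply/allP/asboolP => gx g ggs; have := gx g ggs.
  by apply: contra => /eqP hx; apply/asboolP => _ ->.
by apply: contra => /asboolP hx; apply/eqP/hx.
Qed.

Lemma sum_norm_mobius_flats x :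
  \sum_(u \in flats (hyps gs)) `|mobius_flats (hyps gs) u| * (`[< (u : set V) x >])%:R
  = (multiplicity (hyps gs) x)%:R.
Proof.
under eq_fsbigr => u /set_mem fu do rewrite mobius_flats_normE // mulrC.
rewrite (sum_flats_nbc (fun u => (`[< u x >])%:R)) multiplicity_hyps -subspace1.
rewrite -count_nbc; last by rewrite subspace1.
rewrite -sum1_count natr_sum [RHS]big_mkcond; apply: eq_bigr => U _.
by rewrite mulr1 /subspace /=; case: asboolP => [->|/negP/negbTE ->].
Qed.

End FlatSums.

(** * Integer points and dilation *)

Lemma card_setI_sum (T : choiceType) (B A : set T) : finite_set B ->
  (card (B `&` A))%:Z = \sum_(x \in B) ((`[< A x >])%:R : int).
Proof.
move=> finB; have finBA : finite_set (B `&` A) by exact: finite_setIl.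
transitivity (\sum_(x \in B `&` A) (1 : int)).
  by rewrite fsbig_finite // big_const_seq count_predT iter_addr_0 natz.
rewrite fsbig_mkcondr; apply: eq_fsbigr => x _.
by case: asboolP => [Ax|nAx]; [rewrite mem_set|rewrite memNset].
Qed.

Lemma Posz_fsum (T : choiceType) (A : set T) (n : T -> nat) : finite_set A ->
  (\sum_(x \in A) n x)%:Z = \sum_(x \in A) (n x)%:Z.
Proof. by move=> finA; rewrite !fsbig_finite // (big_morph Posz PoszD (erefl _)). Qed.

Lemma fin_integer_closed_cube {R : realType} {d : nat} (t : nat) :
  finite_set (integer_point `&` closed_cube 0 t%:R : set 'rV[R]_d).
Proof.
pose F (c : {ffun 'I_d -> 'I_t.+1}) : 'rV[R]_d := \row_i (c i)%:R.
apply: (sub_finite_set (B := [set F c | c in setT])); last first.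
  by apply: finite_image; exact: finite_finset.
move=> x [xi xt].
exists [ffun i => inord (Num.truncn (x 0 i))] => //.
apply/rowP => i; rewrite mxE ffunE.
have /andP[x0 x1] := xt i.
have xn : x 0 i \is a Num.nat by rewrite natrEint xi.
by rewrite inordK ?truncnK // -(ltr_nat R) truncnK // (le_lt_trans x1) // ltr_nat.
Qed.

Section Counting.
Context {R : realType} {d : nat}.
Local Notation V := 'rV[R]_d.
Variable gs : seq 'cV[R]_d.
Hypothesis gs_neq0 : {in gs, forall g, g != 0}.
Variable t : nat.
Hypothesis t_gt0 : (0 < t)%N.

Let t0 : 0 < t%:R :> R. Proof. by rewrite ltr0n. Qed.

(** Flats are linear subspaces, hence stable under dilation; this is what turns
    points of the lattice scaled by 1/t into integer points. *)
Lemma flat_scale (u : (set V)^d) (a : R) x : flats (hyps gs) u -> a != 0 ->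
  (u : set V) (a *: x) <-> (u : set V) x.
Proof.
move=> [S [SK -> _]] a0; split => ux h Sh; have [g _ gh] := SK h Sh.
  have := ux h Sh; rewrite -gh /hyp /= formZ => /eqP.
  by rewrite mulf_eq0 (negbTE a0) => /eqP.
by have := ux h Sh; rewrite -gh /hyp /= formZ => ->; rewrite mulr0.
Qed.

Lemma ehrhart_flat (Q Qt : set V) u :
    (forall x, Q (t%:R^-1 *: x) <-> Qt x) -> finite_set (integer_point `&` Qt) ->
    flats (hyps gs) u ->
  (ehrhart (Q `&` u) t)%:Z =
  \sum_(x \in integer_point `&` Qt) ((`[< (u : set V) x >])%:R : int).
Proof.
move=> QQt finQt fu; rewrite -card_setI_sum // /ehrhart.
have tV : t%:R^-1 != 0 :> R by rewrite invr_eq0 gt_eqF.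
rewrite (_ : _ `&` _ = [set t%:R^-1 *: z
  | z in (integer_point `&` Qt) `&` (u : set V)]); last first.
  apply/seteqP; split => x.
    move=> [[Qx ux] [z zi zx]]; exists z => //; rewrite -zx in Qx ux.
    by split; [split => //; exact/QQt|exact/(flat_scale _ _ _ fu tV)].
  move=> [z [[zi Qz] uz] <-]; split; last by exists z.
  by split; [exact/QQt|exact/(flat_scale _ _ _ fu tV)].
rewrite /card fset_set_image; last exact: finite_setIl.
by rewrite card_imfset //; exact: scalerI.
Qed.

Lemma sum_ehrhart_flats (w : (set V)^d -> int) (Q Qt : set V) :
    (forall x, Q (t%:R^-1 *: x) <-> Qt x) -> finite_set (integer_point `&` Qt) ->
  \sum_(u \in flats (hyps gs)) w u * (ehrhart (Q `&` u) t)%:Z =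
  \sum_(x \in integer_point `&` Qt)
    \sum_(u \in flats (hyps gs)) w u * (`[< (u : set V) x >])%:R.
Proof.
move=> QQt finQt; rewrite exchange_fsbig //; last exact: flats_finite.
apply: eq_fsbigr => u /set_mem fu; rewrite (ehrhart_flat Q Qt) //.
by rewrite !fsbig_finite // mulr_sumr.
Qed.

Lemma open_cube_scale x : open_cube 0 1 (t%:R^-1 *: x) <-> open_cube 0 t%:R (x : V).
Proof.
by split => xQ i; have := xQ i;
  rewrite !mxE mulrC pmulr_lgt0 ?invr_gt0 // ltr_pdivrMr // mul1r.
Qed.

Lemma closed_cube_scale x :
  closed_cube 0 1 (t%:R^-1 *: x) <-> closed_cube 0 t%:R (x : V).
Proof.
by split => xQ i; have := xQ i;
  rewrite !mxE mulrC pmulr_lge0 ?invr_gt0 // ler_pdivrMr // mul1r.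
Qed.

Lemma card_complement_flats :
  (card (integer_point `&` open_cube 0 t%:R `&` complement_of (hyps gs)))%:Z =
  \sum_(u \in flats (hyps gs))
    mobius_flats (hyps gs) u * (ehrhart (open_cube 0 1 `&` u) t)%:Z.
Proof.
have finQ : finite_set (integer_point `&` open_cube 0 t%:R : set V).
  apply: sub_finite_set (fin_integer_closed_cube t) => x [xi xQ]; split => // i.
  by have /andP[/ltW -> /ltW ->] := xQ i.
rewrite (sum_ehrhart_flats _ _ (open_cube 0 t%:R)) //; last exact: open_cube_scale.
rewrite card_setI_sum //; apply: eq_fsbigr => x _.
by rewrite sum_mobius_flats.
Qed.

Lemma sum_multiplicity_flats :
  (\sum_(x \in integer_point `&` closed_cube 0 t%:R) multiplicity (hyps gs) x)%:Z =
  \sum_(u \in flats (hyps gs))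
    `|mobius_flats (hyps gs) u| * (ehrhart (closed_cube 0 1 `&` u) t)%:Z.
Proof.
have finQ := @fin_integer_closed_cube R d t.
rewrite (sum_ehrhart_flats _ _ (closed_cube 0 t%:R)) //; last exact: closed_cube_scale.
rewrite Posz_fsum //; apply: eq_fsbigr => x _.
by rewrite sum_norm_mobius_flats // natz.
Qed.

End Counting.

(** * Arrangements of equalities between forms *)

Section PairDifferences.
Context {R : realType} {d : nat}.
Local Notation V := 'rV[R]_d.

(** The values of the forms c at x are pairwise distinct exactly when x avoids
    the kernels of these differences. With the coordinate forms for c this is
    the arrangement of the hyperplanes x_i = x_j. *)
Definition pair_diffs (n : nat) (c : 'I_n -> 'cV[R]_d) : seq 'cV[R]_d :=
  [seq c p.1 - c p.2 | p : 'I_n * 'I_n <- enum {: 'I_n * 'I_n} & (p.1 < p.2)%N].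

Lemma mem_pair_diffs n (c : 'I_n -> 'cV[R]_d) g :
  g \in pair_diffs _ c <-> exists j k : 'I_n, (j < k)%N /\ g = c j - c k.
Proof.
split => [/mapP[[j k]]|[j [k [jk ->]]]].
  by rewrite mem_filter /= => /andP[jk _] ->; exists j, k.
by apply/mapP; exists (j, k) => //; rewrite mem_filter jk mem_enum.
Qed.

Lemma hyps_pair_diffs n (c : 'I_n -> 'cV[R]_d) :
  hyps (pair_diffs _ c) =
  [set h | exists j k : 'I_n, (j < k)%N /\ h = [set x : V | form (c j) x = form (c k) x]].
Proof.
have hypE j k : hyp (c j - c k) = [set x : V | form (c j) x = form (c k) x].
  apply/seteqP; split => x; rewrite /hyp /= formB.
    by move/eqP; rewrite subr_eq0 => /eqP.
  by move=> ->; rewrite subrr.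
apply/seteqP; split => h.
  by move=> [_ /= /mem_pair_diffs[j [k [jk ->]]] <-]; exists j, k.
move=> [j [k [jk ->]]]; exists (c j - c k) => //=.
by apply/mem_pair_diffs; exists j, k.
Qed.

Lemma pair_diffs_neq0 n (c : 'I_n -> 'cV[R]_d) : injective c ->
  {in pair_diffs _ c, forall g, g != 0}.
Proof.
move=> cI _ /mem_pair_diffs[j [k [jk ->]]]; rewrite subr_eq0.
by apply/eqP => /cI E; rewrite E ltnn in jk.
Qed.

Lemma complement_pair_diffs n (c : 'I_n -> 'cV[R]_d) :
  complement_of (hyps (pair_diffs _ c)) =
  [set x : V | injective (fun j => form (c j) x)].
Proof.
rewrite complement_hyps; apply/seteqP; split => x.
  have lt_neq (j k : 'I_n) : {in pair_diffs _ c, forall g, form g x != 0} -> (j < k)%N ->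
      form (c j) x <> form (c k) x.
    move=> cx jk /eqP; rewrite -subr_eq0 -formB; apply/negP/cx.
    by apply/mem_pair_diffs; exists j, k.
  move=> cx j k jk; apply/val_inj.
  have [E|E|//] := ltngtP j k; first by case: (lt_neq j k cx E).
  by case: (lt_neq k j cx E).
move=> cI _ /mem_pair_diffs[j [k [jk ->]]]; rewrite formB subr_eq0.
by apply/eqP => /cI E; rewrite E ltnn in jk.
Qed.

Lemma hyps_cat (gs1 gs2 : seq 'cV[R]_d) :
  hyps (gs1 ++ gs2) = hyps gs1 `|` hyps gs2.
Proof.
apply/seteqP; split => h.
  by move=> [g /=]; rewrite mem_cat => /orP[g1|g2] <-; [left|right]; exists g.
by move=> [|] [g /= gg <-]; exists g => //=; rewrite mem_cat gg ?orbT.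
Qed.

Lemma form_coord (i : 'I_d) (x : V) : form (delta_mx i 0) x = x 0 i.
Proof. by rewrite /form -colE mxE. Qed.

Lemma delta_col_inj : injective (fun i : 'I_d => delta_mx i 0 : 'cV[R]_d).
Proof.
move=> i j /(congr1 (fun g : 'cV[R]_d => g i 0)) /eqP.
by rewrite !mxE !eqxx !andbT eqr_nat; case: (eqVneq i j).
Qed.

Lemma rational_form_ex (f : V -> R) : rational_linear_form f ->
  exists g : 'cV[R]_d, forall x, f x = form g x.
Proof.
move=> [a fa]; exists (\col_i ratr (a 0 i)) => x; rewrite fa /form mxE.
by apply: eq_bigr => i _; rewrite mxE mulrC.
Qed.

End PairDifferences.

Theorem theorem7p4 (R : realType) (d m : nat) (f : 'I_m -> 'rV[R]_d -> R)
    (f_rational : forall j, rational_linear_form (f j))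
    (f_distinct : injective f)
    (f_weight : forall j k, weight (f j) = weight (f k))
    (t : nat) (t_gt0 : (0 < t)%N) :
  [/\ (count_open_star f t)%:Z =
        \sum_(u \in flats (arr_all f))
          mobius_flats (arr_all f) u * (ehrhart (open_cube 0 1 `&` u) t)%:Z,
      (count_closed_star f t)%:Z =
        \sum_(u \in flats (arr_all f))
          `|mobius_flats (arr_all f) u| * (ehrhart (closed_cube 0 1 `&` u) t)%:Z,
      (count_open f t)%:Z =
        \sum_(u \in flats (arr_forms f))
          mobius_flats (arr_forms f) u * (ehrhart (open_cube 0 1 `&` u) t)%:Z
    & (count_closed f t)%:Z =
        \sum_(u \in flats (arr_forms f))
          `|mobius_flats (arr_forms f) u| * (ehrhart (closed_cube 0 1 `&` u) t)%:Z].
Proof.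
have [c fc] := choice (fun j => rational_form_ex (f j) (f_rational j)).
have cI : injective c.
  by move=> j k cjk; apply: f_distinct; apply/funext => x; rewrite !fc cjk.
pose gs1 := pair_diffs _ c.
pose gs2 := pair_diffs _ (fun i : 'I_d => delta_mx i 0 : 'cV[R]_d).
have gs1_neq0 : {in gs1, forall g, g != 0} by exact: pair_diffs_neq0.
have gs2_neq0 : {in gs2, forall g, g != 0}.
  by apply: pair_diffs_neq0; exact: delta_col_inj.
have gs_neq0 : {in gs1 ++ gs2, forall g, g != 0}.
  by move=> g; rewrite mem_cat => /orP[/gs1_neq0|/gs2_neq0].
have formsE : arr_forms f = hyps gs1.
  rewrite hyps_pair_diffs /arr_forms; congr [set h | _]; apply/funext => h.
  by do 2![congr (exists _, _); apply/funext => ?]; under eq_set do rewrite !fc.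
have completeE : arr_complete = hyps gs2.
  rewrite hyps_pair_diffs /arr_complete; congr [set h | _]; apply/funext => h.
  do 2![congr (exists _, _); apply/funext => ?].
  by under [in RHS]eq_set do rewrite !form_coord.
have allE : arr_all f = hyps (gs1 ++ gs2) by rewrite hyps_cat -formsE -completeE.
have gen1 : complement_of (hyps gs1) = [set x | injective (fun j => f j x)].
  rewrite complement_pair_diffs; apply/seteqP; split => x /= xI j k.
    by rewrite !fc; exact: xI.
  by rewrite -!fc; exact: xI.
have gen2 : complement_of (hyps gs2) = [set x | injective (x 0)].
  rewrite complement_pair_diffs; apply/seteqP; split => x /= xI j k.
    by rewrite -!form_coord; exact: xI.
  by rewrite !form_coord; exact: xI.
have gen : complement_of (hyps (gs1 ++ gs2)) =
    [set x | injective (fun j => f j x)] `&` [set x | injective (x 0)].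
  by rewrite -gen1 -gen2 hyps_cat /complement_of bigcup_setU setCU.
rewrite /count_closed_star /count_closed allE formsE.
split; rewrite -?card_complement_flats ?sum_multiplicity_flats //.
  rewrite gen /count_open_star; congr (card _)%:Z.
  by apply/seteqP; split => x => [[xi xQ xf xx]|[[xi xQ] [xf xx]]].
rewrite gen1 /count_open; congr (card _)%:Z.
by apply/seteqP; split => x => [[xi xQ xf]|[[xi xQ] xf]].
Qed.
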